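(* (1) Let $A, B \subset \mathbb{N}$ be infinite sets such that $s_A < \infty$ and $d_{A,B} < \infty$. Then $$\frac{s_A}{4d_{A,B}+1} \le s_B \le (4d_{A,B}+1)s_A.$$ (2) Let $a, b, d$ be positive integers such that $$\frac{a}{4d+1} \le b \le (4d+1)a.$$ Then there exist infinite sets $A, B \subset \mathbb{N}$ such that $s_A = a$, $s_B = b$ and $d_{A,B} = d$.
   Context: $\mathbb{N}$ denotes the set of nonnegative integers. For infinite sets $A = \{a_1 < a_2 < \cdots\}$, $B = \{b_1 < b_2 < \cdots\}$ of nonnegative integers, enumerated increasingly: $R_A(n)$ is the number of pairs $(i,j)$ with $i \le j$ and $a_i + a_j = n$; $s_A(x) = \max_{n \le x} R_A(n)$ and $s_A = \lim_{x\to\infty} s_A(x) \in \mathbb{N}\cup\{\infty\}$ (similarly for $B$); $d_{A,B}(x) = \max\{|a_t - b_t| : a_t \le x \text{ or } b_t \le x\}$ and $d_{A,B} = \lim_{x\to\infty} d_{A,B}(x) \in \mathbb{N}\cup\{\infty\}$. *)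

(* Defs.v *)
From HB Require Import structures.
From mathcomp Require Import all_boot all_order all_algebra.
From mathcomp Require Import all_classical all_reals all_analysis.

Set Implicit Arguments.
Unset Strict Implicit.
Unset Printing Implicit Defensive.

Import Order.TTheory GRing.Theory Num.Theory.
Import numFieldNormedType.Exports.

Local Open Scope classical_set_scope.
Local Open Scope ring_scope.
Local Open Scope nat_scope.

Definition least (A : set nat) : nat := xget 0 (A `&` lbound A).

(** Indices start at 0. For [A] infinite, [elt A] is the increasing
    enumeration of [A]; in particular [t <= elt A t]. For [A] finite the
    values of [elt A] past the elements of [A] are junk. *)
Fixpoint elt (A : set nat) (t : nat) : nat :=
  if t is t'.+1 then least (A `&` [set n | elt A t' < n]) else least A.

(** Bounding the indices by [n] loses no pair, since [i <= elt A i]. *)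
Definition rep (A : set nat) (n : nat) : nat :=
  #|[pred p : 'I_n.+1 * 'I_n.+1 |
      (p.1 <= p.2) && (elt A p.1 + elt A p.2 == n)]|.

Definition max_rep (A : set nat) (x : nat) : nat := \max_(n < x.+1) rep A n.

Definition lim_max_rep (R : realType) (A : set nat) : \bar R :=
  limn (fun x => (max_rep A x)%:R%:E).

(** As in [rep], an index [t] with [elt A t <= x] or [elt B t <= x] is at
    most [x]; the maximum over no index is 0. *)
Definition max_dist (A B : set nat) (x : nat) : nat :=
  \max_(t < x.+1 | (elt A t <= x) || (elt B t <= x)) `|elt A t - elt B t|.

Definition lim_max_dist (R : realType) (A B : set nat) : \bar R :=
  limn (fun x => (max_dist A B x)%:R%:E).

(* Main.v *)
Require Import Defs.
From mathcomp Require Import all_boot all_order all_algebra.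
From mathcomp Require Import all_classical all_reals all_analysis.
From mathcomp Require Import zify.

(** Part (1).  If [b_i + b_j = n] and every [|a_t - b_t|] is at most [d], then
    [a_i + a_j] is one of the [4d + 1] integers of [[n - 2d, n + 2d]], and each
    of these is represented at most [s_A] times by [A]; so [R_B(n)] is at most
    [(4d + 1) s_A] ([rep_perturb_le]).  This makes [s_B] finite, and exchanging
    [A] and [B] gives the other inequality.

    Part (2).  The hypotheses and the conclusion are symmetric in [(A, a)] and
    [(B, b)], so let [a <= b <= (4d + 1) a].  The sequence [base b] is Sidon
    apart from one integer [N], which is the sum of [b] reflected pairs, those
    of indices [i] and [2b - 1 - i] with [i < b] ([base_sidon],
    [base_reflect]).  Multiply it by [M = 4d + 1] and add to its [t]-th term a
    small integer [E t], where [E i + E j < M] always.  Quotient and remainder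
    by [M] recover from a sum of two new terms the sum of the old terms and the
    sum of the perturbations.  Hence a sum has several representations only if
    its quotient is [N], and then it has as many as there are reflected pairs
    with the prescribed total perturbation ([rep_perturb_range_le],
    [rep_perturb_range_ge]).

    For [B] take [E] constant equal to [d]: the [b] reflected pairs all have
    the same sum, and [s_B = b].  For [A] take [E] with values in [[0, 2d]]
    such that the [i]-th reflected pair gets the total [i %/ a] ([spread]).
    These totals are at most [4d] because [b <= (4d + 1) a]; each is attained
    at most [a] times, and [0] exactly [a] times because [a <= b].  So
    [s_A = a].  The [t]-th terms of [A] and [B] differ by [|E t - d| <= d],
    with equality at [t = 0]. *)

Set Implicit Arguments.
Unset Strict Implicit.
Unset Printing Implicit Defensive.

Import Order.TTheory GRing.Theory Num.Theory.

Local Open Scope classical_set_scope.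
Local Open Scope nat_scope.

(** * Monotone sequences of integers and their limits *)

Lemma lim_nat_max (R : realType) (u : nat -> nat) (s x0 : nat) :
  {homo u : x y / x <= y} -> (forall x, u x <= s) -> u x0 = s ->
  limn (fun x => (u x)%:R%:E : \bar R) = s%:R%:E.
Proof.
move=> u_mono u_le u_x0.
apply: lim_near_cst; first exact: ereal_hausdorff.
exists x0 => //= x x0x; congr (_ %:R%:E).
by apply/eqP; rewrite eqn_leq u_le -u_x0 u_mono.
Qed.

(** The limit is a maximum, attained at some index: bounds on the terms transfer
    to it as inequalities between integers. *)
Lemma bounded_nat_lim (R : realType) (u : nat -> nat) (k : nat) :
  {homo u : x y / x <= y} -> (forall x, u x <= k) ->
  exists s, [/\ forall x, u x <= s, exists x, u x = s
              & limn (fun x => (u x)%:R%:E : \bar R) = s%:R%:E].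
Proof.
move=> u_mono u_le.
have ex_value : exists s, `[< exists x, u x = s >].
  by exists (u 0); apply/asboolP; exists 0.
have value_le s : `[< exists x, u x = s >] -> s <= k by move/asboolP=> [x <-].
case: (ex_maxnP ex_value value_le) => s /asboolP[x0 u_x0] s_max.
have u_le_s x : u x <= s by apply: s_max; apply/asboolP; exists x.
exists s; split=> //; first by exists x0.
exact: lim_nat_max u_x0.
Qed.

Lemma finite_nat_lim (R : realType) (u : nat -> nat) :
  {homo u : x y / x <= y} ->
  (limn (fun x => (u x)%:R%:E : \bar R) < +oo)%E ->
  exists s, [/\ forall x, u x <= s, exists x, u x = s
              & limn (fun x => (u x)%:R%:E : \bar R) = s%:R%:E].
Proof.
move=> u_mono lim_fin.
set v : nat -> \bar R := fun x => (u x)%:R%:E.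
have v_mono : {homo v : n m / (n <= m)%N >-> (n <= m)%E}.
  by move=> n m nm; rewrite /v lee_fin ler_nat u_mono.
have v_cvg : cvgn v := ereal_nondecreasing_is_cvgn v_mono.
have v_le x : (v x <= limn v)%E.
  apply: lime_ge => //; exists x => //= y xy; exact: v_mono.
have lim_ge0 : (0 <= limn v)%E by apply: le_trans (v_le 0); rewrite lee_fin.
have lim_fin_num : limn v \is a fin_num by rewrite ge0_fin_numE.
have u_le x : u x <= Num.truncn (fine (limn v)).
  rewrite truncn_ge_nat; last exact: fine_ge0.
  by rewrite -lee_fin fineK //; exact: v_le.
exact: bounded_nat_lim u_mono u_le.
Qed.

Lemma max_rep_mono (A : set nat) : {homo max_rep A : x y / x <= y}.
Proof.
move=> x y xy; apply/bigmax_leqP => n _.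
have n_lt : n < y.+1 by apply: leq_trans (ltn_ord n) _.
exact: (leq_bigmax (Ordinal n_lt)).
Qed.

Lemma max_dist_mono (A B : set nat) : {homo max_dist A B : x y / x <= y}.
Proof.
move=> x y xy; apply/bigmax_leqP => t t_le.
have t_lt : t < y.+1 by apply: leq_trans (ltn_ord t) _.
apply: (leq_bigmax_cond (Ordinal t_lt)).
by case/orP: t_le => /= t_le; rewrite (leq_trans t_le xy) ?orbT.
Qed.

Lemma rep_le_max_rep (A : set nat) n : rep A n <= max_rep A n.
Proof. exact: (leq_bigmax (F := fun i : 'I_n.+1 => rep A i) ord_max). Qed.

Lemma max_rep_leP (A : set nat) s :
  (forall n, rep A n <= s) -> forall x, max_rep A x <= s.
Proof. by move=> A_le x; apply/bigmax_leqP => n _; exact: A_le. Qed.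

Lemma lim_max_rep_eq (R : realType) (A : set nat) s n0 :
  (forall n, rep A n <= s) -> s <= rep A n0 -> lim_max_rep R A = s%:R%:E.
Proof.
move=> A_le A_n0; apply: (@lim_nat_max _ _ _ n0).
- exact: max_rep_mono.
- exact: max_rep_leP.
- apply/eqP; rewrite eqn_leq max_rep_leP //=.
  exact: leq_trans A_n0 (rep_le_max_rep _ _).
Qed.

(** * Increasing enumerations *)

Lemma leastP (A : set nat) : A !=set0 -> (A `&` lbound A) (least A).
Proof.
move=> [a Aa]; apply: xgetPex.
have ex_A : exists n, `[< A n >] by exists a; apply/asboolP.
case: (ex_minnP ex_A) => m /asboolP Am m_min.
by exists m; split=> // n An; apply: m_min; apply/asboolP.
Qed.

Lemma least_eq (A : set nat) m : A m -> lbound A m -> least A = m.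
Proof.
move=> Am lb_m; have [Al lb_l] := leastP (ex_intro _ m Am).
by apply: anti_leq; apply/andP; split; [exact: lb_l | exact: lb_m].
Qed.

Lemma eltS_gt (A : set nat) t : infinite_set A -> elt A t < elt A t.+1.
Proof.
move=> A_inf.
have /infinite_setN0/leastP[[_ ?] _] // : infinite_set (A `&` [set n | elt A t < n]).
apply: infinite_setIl => //; apply: sub_finite_set (finite_II (elt A t).+1).
by move=> n /= /negP; rewrite -leqNgt.
Qed.

Lemma elt_ge (A : set nat) t : infinite_set A -> t <= elt A t.
Proof.
move=> A_inf; elim: t => // t IHt; exact: leq_ltn_trans IHt (eltS_gt t A_inf).
Qed.

Section StrictlyIncreasing.
Variable f : nat -> nat.
Hypothesis f_incr : forall t, f t < f t.+1.

Lemma incr_leq : {mono f : i j / i <= j}.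
Proof. exact/leq_mono/(homo_ltn ltn_trans f_incr). Qed.

Lemma incr_ltn : {mono f : i j / i < j}.
Proof. exact/leqW_mono/incr_leq. Qed.

Lemma elt_range t : elt (range f) t = f t.
Proof.
elim: t => [|t IHt] /=; rewrite ?IHt; apply: least_eq.
- by exists 0.
- by move=> _ [i _ <-]; rewrite leEnat incr_leq.
- by split; [exists t.+1 | exact: f_incr].
- by move=> _ [[i _ <-]] /=; rewrite leEnat incr_ltn incr_leq.
Qed.

Lemma infinite_range_incr : infinite_set (range f).
Proof.
have f_inj : {in [set: nat] &, injective f}.
  move=> i j _ _ fij; apply: anti_leq.
  by rewrite -(incr_leq i) -(incr_leq j) fij leqnn.
by rewrite (eq_finite_set (inj_card_eq f_inj)); exact: infinite_nat.
Qed.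

End StrictlyIncreasing.

(** * Counting representations under a bounded perturbation *)

(** With [K > n] this is [rep A n] for [f = elt A] ([rep_uptoE]); the free index
    bound [K] lets counts for different [n] be compared over the same pairs. *)
Definition rep_upto (f : nat -> nat) (K n : nat) : nat :=
  \sum_(i < K) \sum_(j < K) ((i <= j) && (f i + f j == n)).

Lemma sum_trunc (F : nat -> nat) m K :
  m <= K -> (forall i, m <= i -> F i = 0) -> \sum_(i < K) F i = \sum_(i < m) F i.
Proof.
move=> mK F0; rewrite -!(big_mkord xpredT) (big_cat_nat (n := m)) //=.
by rewrite [X in _ + X]big_nat_cond [X in _ + X]big1 ?addn0 // => i /andP[/andP[/F0]].
Qed.

Lemma rep_uptoE (A : set nat) n K :
  infinite_set A -> n < K -> rep A n = rep_upto (elt A) K n.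
Proof.
move=> A_inf nK.
pose F i j : nat := (i <= j) && (elt A i + elt A j == n).
have out i j : n < maxn i j -> F i j = 0.
  move=> ij; have := elt_ge i A_inf; have := elt_ge j A_inf.
  by rewrite /F; case: eqP => [|_]; rewrite ?andbF //; lia.
have -> : rep_upto (elt A) K n = \sum_(i < n.+1) \sum_(j < n.+1) F i j.
  transitivity (\sum_(i < n.+1) \sum_(j < K) F i j).
    apply: (@sum_trunc (fun i => \sum_(j < K) F i j)) => // i ni.
    by rewrite big1 // => j _; apply: out; lia.
  by apply: eq_bigr => i _; apply: (@sum_trunc (F i)) => // j nj; apply: out; lia.
rewrite /rep -sum1_card big_mkcond pair_big /=.
by apply: eq_bigr => p _; rewrite inE /F; case: (_ && _).
Qed.

(** Each pair counted by [rep B n] is counted by [rep A m] for a unique [m] with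
    [|m - n| <= 2d]. *)
Lemma rep_perturb_le (A B : set nat) d s n :
  infinite_set A -> infinite_set B ->
  (forall t, `|elt A t - elt B t| <= d) -> (forall m, rep A m <= s) ->
  rep B n <= (4 * d + 1) * s.
Proof.
move=> A_inf B_inf AB_le A_le; set K := (n + 4 * d).+1.
have nK : n < K by rewrite /K; lia.
rewrite (rep_uptoE B_inf nK) /rep_upto.
(* The shift is [u - 2d]; for [n + u < 2d] the truncated subtraction gives the
   sum [0], which only enlarges the upper bound. *)
pose hit u i j := (i <= j) && (elt A i + elt A j == n + u - 2 * d) : nat.
apply: (@leq_trans (\sum_(u < 4 * d + 1) \sum_(i < K) \sum_(j < K) hit u i j)).
  rewrite [X in _ <= X]exchange_big /=; apply: leq_sum => i _.
  rewrite [X in _ <= X]exchange_big /=; apply: leq_sum => j _.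
  case: (boolP (_ && _)) => // /andP[ij /eqP Bij].
  have := AB_le i; have := AB_le j => Aj Ai.
  have u_lt : elt A i + elt A j + 2 * d - n < 4 * d + 1 by lia.
  rewrite (bigD1 (Ordinal u_lt)) //= /hit ij /=.
  by rewrite (_ : _ == _) //; apply/eqP; lia.
have -> : (4 * d + 1) * s = \sum_(u < 4 * d + 1) s by rewrite sum_nat_const card_ord.
apply: leq_sum => u _; rewrite -[X in X <= _](@rep_uptoE A) //.
by rewrite /K; have := ltn_ord u; lia.
Qed.

Lemma elt_dist_le (A B : set nat) D :
  infinite_set A -> (forall x, max_dist A B x <= D) ->
  forall t, `|elt A t - elt B t| <= D.
Proof.
move=> A_inf D_le t; apply: leq_trans (D_le (elt A t)).
have t_lt : t < (elt A t).+1 := elt_ge t A_inf.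
by apply: (leq_bigmax_cond (Ordinal t_lt)); rewrite /= leqnn.
Qed.

Lemma lim_max_rep_bounds (R : realType) (A B : set nat) :
  infinite_set A -> infinite_set B ->
  (lim_max_rep R A < +oo)%E -> (lim_max_dist R A B < +oo)%E ->
  (lim_max_rep R A / (4%:E * lim_max_dist R A B + 1) <= lim_max_rep R B)%E
  /\
  (lim_max_rep R B <= (4%:E * lim_max_dist R A B + 1) * lim_max_rep R A)%E.
Proof.
move=> A_inf B_inf A_fin AB_fin; rewrite /lim_max_rep /lim_max_dist.
have [sA [sA_max [xA sA_eq] ->]] := finite_nat_lim (@max_rep_mono A) A_fin.
have [d [d_max _ ->]] := finite_nat_lim (@max_dist_mono A B) AB_fin.
have AB_le := elt_dist_le A_inf d_max.
have BA_le t : `|elt B t - elt A t| <= d by have := AB_le t; lia.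
have A_le m : rep A m <= sA := leq_trans (rep_le_max_rep A m) (sA_max m).
have B_le m := rep_perturb_le m A_inf B_inf AB_le A_le.
have [sB [sB_max [xB sB_eq] lim_B]] :=
  bounded_nat_lim R (@max_rep_mono B) (max_rep_leP B_le).
rewrite lim_B.
have B_le' m : rep B m <= sB := leq_trans (rep_le_max_rep B m) (sB_max m).
(* The roles of [A] and [B] are exchanged, which is legitimate only now that
   [sB] is known to be finite. *)
have sA_le : sA <= (4 * d + 1) * sB.
  by rewrite -sA_eq; apply: max_rep_leP => m; exact: rep_perturb_le BA_le B_le'.
have sB_le : sB <= (4 * d + 1) * sA by rewrite -sB_eq; exact: max_rep_leP.
have c_gt0 : (0 < 4 * d%:R + 1 :> R)%R by rewrite ltr_wpDl // mulr_ge0.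
have cE : (4 * d%:R + 1 = (4 * d + 1)%:R :> R)%R by rewrite natrD natrM.
rewrite -EFinM -EFinD -EFinM inver gt_eqF // -EFinM !lee_fin; split.
  by rewrite ler_pdivrMr // cE -natrM ler_nat mulnC.
by rewrite cE -natrM ler_nat.
Qed.

(** * A Sidon sequence with one popular sum *)

(** The larger exponent is determined by size, because
    [3 ^ i + 3 ^ j < 3 ^ (maxn i j).+1]. *)
Lemma expn3_sidon i j k l :
  3 ^ i + 3 ^ j = 3 ^ k + 3 ^ l -> i = k /\ j = l \/ i = l /\ j = k.
Proof.
have le_top i' j' k' l' :
    i' <= j' -> 3 ^ i' + 3 ^ j' = 3 ^ k' + 3 ^ l' -> l' <= j'.
  move=> ij eq_sum; rewrite leqNgt; apply/negP => jl.
  have : 3 ^ i' <= 3 ^ j' by rewrite leq_exp2l.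
  have : 3 ^ j'.+1 <= 3 ^ l' by rewrite leq_exp2l.
  have := expn_gt0 3 k'; rewrite expnS; lia.
have ordered i' j' k' l' : i' <= j' -> k' <= l' ->
    3 ^ i' + 3 ^ j' = 3 ^ k' + 3 ^ l' -> i' = k' /\ j' = l'.
  move=> ij kl eq_sum; have jl : j' = l'.
    apply: anti_leq.
    by rewrite (le_top _ _ _ _ ij eq_sum) (le_top _ _ _ _ kl (esym eq_sum)).
  split=> //; apply/eqP; rewrite -(eqn_exp2l _ _ (m := 3)) //; apply/eqP.
  by move: eq_sum; rewrite jl; lia.
move=> e; case: (leqP i j) => [ij | /ltnW ji]; case: (leqP k l) => [kl | /ltnW lk].
- by left; exact: ordered.
- by right; apply: ordered => //; rewrite e addnC.
- by right; have [] : j = k /\ i = l by apply: ordered => //; rewrite -e addnC.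
- by left; have [] : j = l /\ i = k by apply: ordered => //; lia.
Qed.

(** The first [2b] terms form a set invariant under [x -> 3 ^ (2 * b) - x]; the
    later ones exceed twice every earlier term. *)
Definition base (b t : nat) : nat :=
  if t < b then 3 ^ t
  else if t < 2 * b then 3 ^ (2 * b) - 3 ^ (2 * b - t.+1)
  else 3 ^ t.+1.

Section Base.
Variable b : nat.
Hypothesis b_gt0 : 0 < b.

Lemma expn3_small t : t < b -> 0 < 3 ^ t /\ 3 * 3 ^ t <= 3 ^ b.
Proof. by move=> tb; rewrite expn_gt0 -expnS leq_exp2l. Qed.

Lemma expn3_gap : 3 * 3 ^ b <= 3 ^ (2 * b).
Proof. by rewrite -expnS leq_exp2l //; lia. Qed.

Lemma base_low t : t < b -> base b t = 3 ^ t.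
Proof. by rewrite /base => ->. Qed.

Lemma base_mid t : t < b -> base b (2 * b - t.+1) + 3 ^ t = 3 ^ (2 * b).
Proof.
move=> tb; rewrite /base ifF; last by apply/negP; lia.
rewrite ifT; last by lia.
rewrite (_ : 2 * b - (2 * b - t.+1).+1 = t); last by lia.
by rewrite subnK // leq_exp2l //; lia.
Qed.

Lemma base_high t : 2 * b <= t -> base b t = 3 ^ t.+1.
Proof. by move=> bt; rewrite /base !ifF //; apply/negP; lia. Qed.

Lemma base_reflect t : t < b -> base b t + base b (2 * b - t.+1) = 3 ^ (2 * b).
Proof. by move=> tb; rewrite (base_low tb) -(base_mid tb) addnC. Qed.

Lemma base_lt t : t < 2 * b -> base b t < 3 ^ (2 * b).
Proof.
move=> tb; have gap := expn3_gap; case: (ltnP t b) => [t_lt | t_ge].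
  by have := expn3_small t_lt; rewrite (base_low t_lt); lia.
have r_lt : 2 * b - t.+1 < b by lia.
have := base_mid r_lt; have := expn3_small r_lt.
by rewrite (_ : 2 * b - (2 * b - t.+1).+1 = t); lia.
Qed.

Lemma base_incr t : base b t < base b t.+1.
Proof.
have gap := expn3_gap.
case: (ltnP t.+1 b) => [t_lt | t_ge].
  rewrite !base_low ?expnS //; last by lia.
  by have := expn_gt0 3 t; lia.
case: (ltnP t.+1 (2 * b)) => [t_lt | t_ge2].
  have r_lt : 2 * b - t.+2 < b by lia.
  have := base_mid r_lt; have := expn3_small r_lt.
  rewrite (_ : 2 * b - (2 * b - t.+2).+1 = t.+1); last by lia.
  move=> [pos small] mid; case: (ltnP t b) => [tb | bt].
    by have := expn3_small tb; rewrite (base_low tb); lia.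
  have r_lt' : 2 * b - t.+1 < b by lia.
  have := base_mid r_lt'.
  rewrite (_ : 2 * b - (2 * b - t.+1).+1 = t); last by lia.
  rewrite (_ : 2 * b - t.+1 = (2 * b - t.+2).+1) ?expnS; lia.
rewrite [X in _ < X]base_high //; case: (ltnP t (2 * b)) => [tb | bt].
  by apply: leq_trans (base_lt tb) _; rewrite leq_exp2l //; lia.
by rewrite base_high // ltn_exp2l.
Qed.

Lemma base_dominates t l : t < l -> 2 * b <= l -> 2 * base b t < base b l.
Proof.
move=> tl bl; rewrite (base_high bl); case: (ltnP t (2 * b)) => [tb | bt].
  have := base_lt tb; have : 3 ^ (2 * b).+1 <= 3 ^ l.+1 by rewrite leq_exp2l.
  by rewrite expnS; lia.
rewrite (base_high bt); have : 3 ^ t.+2 <= 3 ^ l.+1 by rewrite leq_exp2l.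
by rewrite [3 ^ t.+2]expnS; have := expn_gt0 3 t.+1; lia.
Qed.

(** The exceptional case says that both pairs are reflected pairs. *)
Lemma base_sidon i j k l :
  i <= j -> k <= l -> base b i + base b j = base b k + base b l ->
  i = k /\ j = l \/ (i + j).+1 = 2 * b /\ (k + l).+1 = 2 * b.
Proof.
move=> ij kl eq_sum.
have base_leq := incr_leq base_incr.
case: (ltnP (maxn j l) (2 * b)) => [small | big]; last first.
  left; have base_ij : base b i <= base b j by rewrite base_leq.
  have base_kl : base b k <= base b l by rewrite base_leq.
  have jl : j = l.
    case: (ltngtP j l) => // lt_jl.
      have : 2 * base b j < base b l by apply: base_dominates => //; lia.
      by lia.
    have : 2 * base b l < base b j by apply: base_dominates => //; lia.
    by lia.
  split=> //; apply: anti_leq; rewrite -(base_leq i) -(base_leq k).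
  by move: eq_sum; rewrite jl; lia.
have gap := expn3_gap.
have view t : t < 2 * b ->
    (t < b /\ (base b t = 3 ^ t /\ 3 * 3 ^ t <= 3 ^ b)) \/
    exists r, [/\ r < b, t = 2 * b - r.+1, base b t + 3 ^ r = 3 ^ (2 * b)
                & 3 * 3 ^ r <= 3 ^ b].
  move=> tb; case: (ltnP t b) => [t_lt | t_ge].
    by left; rewrite (base_low t_lt); have [] := expn3_small t_lt.
  right; exists (2 * b - t.+1); have r_lt : 2 * b - t.+1 < b by lia.
  have := base_mid r_lt; have [_ sm] := expn3_small r_lt.
  by rewrite (_ : 2 * b - (2 * b - t.+1).+1 = t); [split | ]; lia.
have P_gt0 := expn_gt0 3 b.
have [i_lt j_lt k_lt l_lt] : [/\ i < 2 * b, j < 2 * b, k < 2 * b & l < 2 * b].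
  by split; lia.
(* Sizes alone exclude the cases in which [i, j] and [k, l] do not have the same
   numbers of small terms [3 ^ t] and of reflected terms [3 ^ (2 * b) - 3 ^ r]. *)
case: (view _ i_lt) (view _ j_lt) (view _ k_lt) (view _ l_lt)
  => [[iL [iE iS]] | [i' [iL iR iE iS]]] [[jL [jE jS]] | [j' [jL jR jE jS]]]
     [[kL [kE kS]] | [k' [kL kR kE kS]]] [[lL [lE lS]] | [l' [lL lR lE lS]]];
  try by exfalso; lia.
- have : 3 ^ i + 3 ^ j = 3 ^ k + 3 ^ l by lia.
  by case/expn3_sidon; lia.
(* With [3 ^ i - 3 ^ j' = 3 ^ k - 3 ^ l'], either the pairs are equal or both
   sides vanish, which is the exceptional sum. *)
- have : 3 ^ i + 3 ^ l' = 3 ^ k + 3 ^ j' by lia.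
  by case/expn3_sidon; lia.
- have : 3 ^ i' + 3 ^ j' = 3 ^ k' + 3 ^ l' by lia.
  by case/expn3_sidon; lia.
Qed.

End Base.

(** * Perturbing the popular sum *)

(** The [i]-th reflected pair has indices [i] and [2b - 1 - i]; the perturbation
    [E] moves its sum by the total compared with [v]. *)
Definition pair_mult (b : nat) (E : nat -> nat) (v : nat) : nat :=
  #|[pred i : 'I_b | E i + E (2 * b - i.+1) == v]|.

Section Perturbation.
Variables (b M : nat) (E : nat -> nat).
Hypothesis b_gt0 : 0 < b.
Hypothesis E_small : forall i j, E i + E j < M.

Definition perturb (t : nat) : nat := M * base b t + E t.

Lemma perturb_incr t : perturb t < perturb t.+1.
Proof.
rewrite /perturb.
have : M * (base b t).+1 <= M * base b t.+1 by rewrite leq_mul2l base_incr ?orbT.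
by have := E_small t t; rewrite mulnS; lia.
Qed.

(** The perturbations of two terms add up to less than the scale [M], so they
    form the remainder of the sum. *)
Lemma perturb_sum i j :
  (perturb i + perturb j) %/ M = base b i + base b j /\
  (perturb i + perturb j) %% M = E i + E j.
Proof.
have M_gt0 : 0 < M by apply: leq_trans (E_small 0 0).
have -> : perturb i + perturb j = (base b i + base b j) * M + (E i + E j).
  by rewrite /perturb; lia.
by rewrite divnMDl // modnMDl divn_small // modn_small // addn0.
Qed.

(** Either a representation is not a reflected pair, and it is the only one; or
    all of them are, and they share the total perturbation [n %% M]. *)
Lemma rep_perturb_range_le s n :
  0 < s -> (forall v, pair_mult b E v <= s) -> rep (range perturb) n <= s.
Proof.
move=> s_gt0 mult_le; rewrite /rep.
set P := [pred p | _].
have [p0 Pp0|/eq_card0->//] := pickP P.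
have sum_eq p : p \in P -> [/\ p.1 <= p.2, perturb p.1 + perturb p.2 = n &
    p = p0 \/ (p.1 + p.2).+1 = 2 * b /\ (p0.1 + p0.2).+1 = 2 * b].
  rewrite inE !(elt_range perturb_incr) => /andP[p_le /eqP p_sum]; split=> //.
  move: Pp0; rewrite /P /= !(elt_range perturb_incr) => /andP[p0_le /eqP p0_sum].
  have : base b p.1 + base b p.2 = base b p0.1 + base b p0.2.
    by rewrite -!(perturb_sum _ _).1 p_sum p0_sum.
  case/(base_sidon b_gt0 p_le p0_le) => [[/val_inj e1 /val_inj e2]|]; last by right.
  by left; case: p p0 e1 e2 {p_le p_sum p0_le p0_sum} => [? ?] [? ?] /= -> ->.
have [popular | unpopular] := eqVneq (p0.1 + p0.2).+1 (2 * b); last first.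
  apply: leq_trans s_gt0; rewrite -(card1 p0); apply: subset_leq_card.
  apply/fintype.subsetP => p /sum_eq[_ _ [-> | [_ p0_sum]]]; first by rewrite inE.
  by rewrite p0_sum eqxx in unpopular.
apply: leq_trans (mult_le (n %% M)).
have sum_pair p : p \in P -> p.1 < b /\ p.2 = 2 * b - p.1.+1 :> nat.
  case/sum_eq => p_le _ p_or.
  have : (p.1 + p.2).+1 = 2 * b by case: p_or => [-> | []].
  lia.
pose first (p : 'I_n.+1 * 'I_n.+1) : 'I_b := insubd (Ordinal b_gt0) (val p.1).
have firstE p : p \in P -> first p = p.1 :> nat.
  by case/sum_pair => p_lt _; rewrite /first val_insubd p_lt.
rewrite -(card_in_image (f := first)).
  apply: subset_leq_card; apply/fintype.subsetP => _ /fintype.imageP[p Pp ->].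
  have [_ p_sum _] := sum_eq _ Pp; have [_ p2E] := sum_pair _ Pp.
  by rewrite inE (firstE _ Pp) -p2E -(perturb_sum p.1 p.2).2 p_sum.
move=> p p' Pp Pp' /(congr1 val) /=; rewrite !firstE //.
have [_ e2] := sum_pair _ Pp; have [_ e2'] := sum_pair _ Pp' => e1.
have {}e2 : p.2 = p'.2 by apply: val_inj; rewrite /= e2 e2' e1.
by move: e1 e2; case: p p' {Pp Pp' e2'} => [? ?] [? ?] /= /val_inj -> ->.
Qed.

Lemma rep_perturb_range_ge v :
  pair_mult b E v <= rep (range perturb) (M * 3 ^ (2 * b) + v).
Proof.
set n := M * _ + _.
have f_ge t : t <= perturb t.
  rewrite -(elt_range perturb_incr); exact: elt_ge (infinite_range_incr perturb_incr).
have pair_sum (i : 'I_b) : E i + E (2 * b - i.+1) == v ->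
    perturb i + perturb (2 * b - i.+1) = n.
  by rewrite /perturb /n -(base_reflect b_gt0 (ltn_ord i)) => /eqP <-; lia.
pose pair (i : 'I_b) : 'I_n.+1 * 'I_n.+1 :=
  (inord (val i), inord (2 * b - i.+1)).
have pairE (i : 'I_b) : E i + E (2 * b - i.+1) == v ->
    (pair i).1 = i :> nat /\ (pair i).2 = 2 * b - i.+1 :> nat.
  move/pair_sum => i_sum; have ge1 := f_ge i; have ge2 := f_ge (2 * b - i.+1).
  by rewrite /= !inordK; lia.
rewrite /pair_mult /rep -(card_in_image (f := pair)).
  apply: subset_leq_card; apply/fintype.subsetP => _ /fintype.imageP[i iv ->].
  rewrite inE in iv; have [e1 e2] := pairE _ iv.
  rewrite inE !(elt_range perturb_incr) e1 e2 (pair_sum _ iv) eqxx andbT.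
  by have := ltn_ord i; lia.
move=> i i' iv iv' pair_eq; rewrite !inE in iv iv'; apply: val_inj => /=.
by rewrite -(pairE _ iv).1 -(pairE _ iv').1 pair_eq.
Qed.

Lemma lim_max_rep_perturb (R : realType) s v0 :
  0 < s -> (forall v, pair_mult b E v <= s) -> s <= pair_mult b E v0 ->
  lim_max_rep R (range perturb) = s%:R%:E.
Proof.
move=> s_gt0 mult_le mult_ge.
apply: (@lim_max_rep_eq _ _ _ (M * 3 ^ (2 * b) + v0)).
  by move=> n; exact: rep_perturb_range_le.
exact: leq_trans mult_ge (rep_perturb_range_ge v0).
Qed.

End Perturbation.

(** The total [t %/ a] wanted for a reflected pair is split between its two
    terms, the first taking as much as the bound [2 * d] allows. *)
Definition spread (a b d t : nat) : nat :=
  if t < b then minn (t %/ a) (2 * d)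
  else if t < 2 * b then (2 * b - t.+1) %/ a - 2 * d
  else 0.

(** The hypothesis makes the total at most [4 * d], so the second term of a
    reflected pair receives at most [2 * d] as well. *)
Lemma spread_le a b d t :
  0 < a -> b <= (4 * d + 1) * a -> spread a b d t <= 2 * d.
Proof.
move=> a_gt0 b_le; rewrite /spread; case: (ltnP t b) => [_ | t_ge]; first exact: geq_minr.
case: ifP => // t_lt.
have : (2 * b - t.+1) %/ a < 4 * d + 1 by rewrite ltn_divLR //; lia.
lia.
Qed.

Lemma spread_pair a b d i :
  i < b -> spread a b d i + spread a b d (2 * b - i.+1) = i %/ a.
Proof.
move=> i_lt; rewrite /spread i_lt ifF; last by apply/negP; lia.
rewrite ifT; last by lia.
by rewrite (_ : 2 * b - (2 * b - i.+1).+1 = i); lia.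
Qed.

Lemma pair_mult_spread_le a b d v : 0 < a -> pair_mult b (spread a b d) v <= a.
Proof.
move=> a_gt0.
pose rem (i : 'I_b) : 'I_a := Ordinal (ltn_pmod i a_gt0).
rewrite /pair_mult -[X in _ <= X]card_ord -(card_in_image (f := rem)) ?max_card //.
move=> i i'; rewrite !inE !spread_pair // => /eqP iv /eqP iv' /(congr1 val) /= e.
by apply: val_inj; rewrite /= (divn_eq i a) (divn_eq i' a) iv iv' e.
Qed.

Lemma pair_mult_spread0 a b d : 0 < a -> a <= b -> a <= pair_mult b (spread a b d) 0.
Proof.
move=> a_gt0 ab.
have widen_inj : injective (widen_ord ab) by move=> i i' /(congr1 val) /= /val_inj.
rewrite /pair_mult -[X in X <= _]card_ord -(fintype.card_image widen_inj).
apply: subset_leq_card; apply/fintype.subsetP => _ /fintype.imageP[i _ ->].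
by rewrite inE spread_pair /= ?divn_small // (leq_trans (ltn_ord i) ab).
Qed.

Lemma pair_mult_cst b d : pair_mult b (fun=> d) (2 * d) = b.
Proof.
rewrite /pair_mult -[RHS]card_ord; apply: eq_card => i.
by rewrite inE addnn mul2n eqxx.
Qed.

Lemma pair_mult_le b E v : pair_mult b E v <= b.
Proof. by rewrite /pair_mult -[X in _ <= X]card_ord max_card. Qed.

Lemma max_distC A B : max_dist A B = max_dist B A.
Proof.
apply/funext => x; apply: eq_big => [t | t _]; first by rewrite orbC.
by lia.
Qed.

Lemma sets_of_max_reps (R : realType) (a b d : nat) :
  0 < a -> a <= b -> b <= (4 * d + 1) * a ->
  exists A B : set nat,
    [/\ infinite_set A, infinite_set B, lim_max_rep R A = a%:R%:E,
        lim_max_rep R B = b%:R%:E & lim_max_dist R A B = d%:R%:E].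
Proof.
move=> a_gt0 ab b_le; have b_gt0 : 0 < b by exact: leq_trans ab.
set M := 4 * d + 1; set E := spread a b d.
have E_le t : E t <= 2 * d by exact: spread_le.
have E_small i j : E i + E j < M by have := E_le i; have := E_le j; rewrite /M; lia.
have d_small (i j : nat) : d + d < M by rewrite /M; lia.
have A_incr := perturb_incr b_gt0 E_small.
have B_incr := perturb_incr b_gt0 (E := fun=> d) d_small.
exists (range (perturb b M E)), (range (perturb b M (fun=> d))); split.
- exact: infinite_range_incr.
- exact: infinite_range_incr.
- apply: (lim_max_rep_perturb b_gt0 E_small R a_gt0) => [v|].
    exact: pair_mult_spread_le.
  exact: pair_mult_spread0.
- apply: (lim_max_rep_perturb b_gt0 (E := fun=> d) d_small R (v0 := 2 * d) b_gt0) => [v|].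
    exact: pair_mult_le.
  by rewrite pair_mult_cst.
have dist_le x : max_dist (range (perturb b M E)) (range (perturb b M (fun=> d))) x <= d.
  apply/bigmax_leqP => t _; rewrite !elt_range // /perturb.
  by have := E_le t; lia.
apply: (@lim_nat_max _ _ _ M); first exact: max_dist_mono.
  exact: dist_le.
apply/eqP; rewrite eqn_leq dist_le /=.
have E0 : E 0 = 0 by rewrite /E /spread b_gt0 div0n min0n.
have A0 : elt (range (perturb b M E)) 0 = M.
  by rewrite elt_range // /perturb E0 base_low // muln1 addn0.
have B0 : elt (range (perturb b M (fun=> d))) 0 = M + d.
  by rewrite elt_range // /perturb base_low // muln1.
apply: (leq_trans _ (leq_bigmax_cond (ord0 : 'I_M.+1) _)).
  by rewrite [nat_of_ord _]/= A0 B0; lia.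
by rewrite [nat_of_ord _]/= A0 leqnn.
Qed.

Theorem theorem3 (R : realType) :
  (forall A B : set nat,
     infinite_set A -> infinite_set B ->
     (lim_max_rep R A < +oo)%E -> (lim_max_dist R A B < +oo)%E ->
     (lim_max_rep R A / (4%:E * lim_max_dist R A B + 1) <= lim_max_rep R B)%E
     /\
     (lim_max_rep R B <= (4%:E * lim_max_dist R A B + 1) * lim_max_rep R A)%E)
  /\
  (forall a b d : nat,
     (0 < a)%N -> (0 < b)%N -> (0 < d)%N ->
     (a%:R / (4 * d%:R + 1) <= b%:R :> R)%R ->
     (b%:R <= (4 * d%:R + 1) * a%:R :> R)%R ->
     exists A B : set nat,
       infinite_set A /\ infinite_set B /\
       lim_max_rep R A = (a%:R)%:E /\
       lim_max_rep R B = (b%:R)%:E /\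
       lim_max_dist R A B = (d%:R)%:E).
Proof.
split=> [A B | a b d a_gt0 b_gt0 _]; first exact: lim_max_rep_bounds.
have cE : (4 * d%:R + 1 = (4 * d + 1)%:R :> R)%R by rewrite natrD natrM.
rewrite cE ler_pdivrMr; last by rewrite ltr0n; lia.
rewrite -!natrM !ler_nat => a_le b_le.
case: (leqP a b) => [ab | /ltnW ba].
  by have [A [B [? ? ? ? ?]]] := sets_of_max_reps R a_gt0 ab b_le; exists A, B.
rewrite mulnC in a_le.
have [B [A [? ? ? ? dist]]] := sets_of_max_reps R b_gt0 ba a_le.
by exists A, B; rewrite /lim_max_dist max_distC.
Qed.
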